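(* Let $m,n$ be positive integers with $d=m-n>0$. Then every real root of the polynomial $P_{(m,n)}$ belongs to $\{0,n\}$; that is, $\{z\in\mathbb{R}: P_{(m,n)}(z)=0\}\subseteq\{0,n\}$.
   Context: $S(m,n)$ denotes the Stirling number of the second kind. For positive integers $m,n$ with $d=m-n>0$, define the polynomial $P_{(m,n)}(z)=\sum_{j=1}^{d}\binom{m}{j}S(m-j,n)(-z)^{j}$. *)

(* Defs.v *)
From mathcomp Require Import all_boot all_order all_algebra.

Set Implicit Arguments.
Unset Strict Implicit.
Unset Printing Implicit Defensive.

Import GRing.Theory.
Local Open Scope ring_scope.

(* Stirling number of the second kind S(m, n): the number of partitions of an
   m-element set into n nonempty blocks ([partition] excludes empty blocks). *)
Definition stirling2 (m n : nat) : nat :=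
  #|[set Q : {set {set 'I_m}} | partition Q [set: 'I_m] & #|Q| == n]|.

(* P_(m,n)(z) = \sum_(j=1)^d C(m,j) S(m-j,n) (-z)^j with d = m - n; only
   meaningful for n < m, since the subtraction is truncated. *)
Definition stirling_poly (R : nzRingType) (m n : nat) : {poly R} :=
  \sum_(1 <= j < (m - n).+1) ('C(m, j) * stirling2 (m - j) n)%N%:R * (- 'X) ^+ j.

(* Main.v *)
Require Import Defs.
From HB Require Import structures.
From mathcomp Require Import all_boot all_order all_algebra.
From mathcomp Require Import reals.
From mathcomp Require Import polyrcf.
From mathcomp Require Import ring.

Set Implicit Arguments.
Unset Strict Implicit.
Unset Printing Implicit Defensive.

Import Order.TTheory GRing.Theory Num.Theory.
Local Open Scope ring_scope.

(** Let D be the forward difference operator, (D p)(x) = p(x + 1) - p(x), and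
    let F = D^n X^m. Classifying the functions from an m-set to an x-set by
    their kernel partition gives x^m = sum_k S(m,k) k! C(x,k), and D lowers
    the index of C(x,k) by one; hence F(0) = n! S(m,n). As D commutes with
    translations, the binomial theorem then gives
      F(y) = n! sum_j C(m,j) S(m-j,n) y^j,
    so that n! P_(m,n)(z) = F(-z) - F(0) ([horner_stirling_poly]): the roots
    of P_(m,n) are the z such that F takes the same value at -z and at 0.

    Write m = n + d. The shape of F depends only on the parity of d.
    - For odd d, F is strictly increasing ([fdiff_Xn_increasing]). This goes by
      induction on n: the derivative of D^(n+1) X^(n+1+d) is, up to a positive
      factor, D (D^n X^(n+d)), which is positive because D^n X^(n+d) is
      strictly increasing. Hence z = 0 is the only root.
    - For even d, F' is a positive multiple of D^n X^(n+d-1), which is strictly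
      increasing by the odd case, so by Rolle's theorem F takes no value three
      times ([no_three_on_level]). Since F(-n) = F(0) by the reflection
      x -> -n - x ([fdiff_Xn_reflect]), F(-z) = F(0) forces z = 0 or z = n. *)

(** * Counting functions by their kernel *)

Section Kernel.
Variables T rT : finType.

(** Functions with kernel Q are the pullbacks of injective functions on the
    set of blocks of Q. *)
Lemma card_preim_partition (Q : {set {set T}}) : partition Q [set: T] ->
  #|[set f : {ffun T -> rT} | preim_partition f [set: T] == Q]|
    = (#|rT| ^_ #|Q|)%N.
Proof.
move=> partQ; have [/eqP covQ tiQ nzQ] := and3P partQ.
have covT x : x \in cover Q by rewrite covQ inE.
pose block x : {A | A \in Q} := Sub (pblock Q x) (pblock_mem (covT x)).
have block_onto (B : {A | A \in Q}) : exists x, block x == B.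
  have [x Bx]: exists x, x \in val B.
    by apply/set0Pn; apply: contraNneq nzQ => <-; exact: valP.
  by exists x; apply/eqP/val_inj; exact: def_pblock tiQ (valP B) Bx.
pose pull (g : {ffun {A | A \in Q} -> rT}) := [ffun x => g (block x)].
have pull_inj : injective pull.
  move=> g h /ffunP eq_gh; apply/ffunP => B; have [x /eqP <-] := block_onto B.
  by have := eq_gh x; rewrite !ffunE.
have -> : #|Q| = #|{: {A | A \in Q}}| by rewrite card_sig.
rewrite -card_inj_ffuns -(card_imset _ pull_inj); apply: eq_card => f.
rewrite inE; apply/eqP/imsetP => [kerf | [g]].
  have fE x y : (f x == f y) = (block x == block y).
    rewrite -val_eqE /= eq_pblock // -kerf.
    rewrite (pblock_equivalence_partition (R := fun x y => f x == f y)) ?inE //.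
    by split=> // /eqP->.
  (* A choice of a point in each block, so that f descends to the blocks. *)
  pose pick_in (B : {A | A \in Q}) := xchoose (block_onto B).
  have pickK B : block (pick_in B) = B.
    by apply/eqP; exact: xchooseP (block_onto B).
  exists [ffun B => f (pick_in B)].
    rewrite inE; apply/injectiveP => B C; rewrite !ffunE => /eqP.
    by rewrite fE !pickK => /eqP.
  by apply/ffunP => x; rewrite !ffunE; apply/eqP; rewrite fE pickK.
rewrite inE => /injectiveP g_inj ->.
rewrite -[RHS](preim_partition_pblock partQ).
apply: eq_in_imset => x _; apply/setP => y.
by rewrite !inE !ffunE (inj_eq g_inj) -val_eqE.
Qed.

Lemma expn_sum_partition :
  (#|rT| ^ #|T|)%N
    = (\sum_(Q : {set {set T}} | partition Q [set: T]) #|rT| ^_ #|Q|)%N.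
Proof.
rewrite -card_ffun -sum1_card.
rewrite (partition_big (fun f : {ffun T -> rT} => preim_partition f [set: T])
           (fun Q => partition Q [set: T])) /=; last first.
  by move=> f _; exact: preim_partitionP.
apply: eq_bigr => Q partQ; rewrite -card_preim_partition // -sum1_card.
by apply: eq_bigl => f; rewrite inE.
Qed.
End Kernel.

Lemma leq_card_partition (T : finType) (D : {set T}) (Q : {set {set T}}) :
  partition Q D -> (#|Q| <= #|D|)%N.
Proof.
move=> partQ; rewrite (card_partition partQ) -sum1_card; apply: leq_sum => A QA.
by rewrite card_gt0; case/and3P: partQ => _ _; apply: contraNneq => <-.
Qed.

Lemma stirling2_small (m n : nat) : (m < n)%N -> stirling2 m n = 0%N.
Proof.
move=> lt_mn; apply/eqP; rewrite cards_eq0 -subset0; apply/subsetP => Q.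
rewrite inE => /andP[/leq_card_partition]; rewrite cardsT card_ord.
move=> leQ /eqP eqQ.
by move: lt_mn; rewrite -eqQ ltnNge leQ.
Qed.

(** The expansion of a power in falling factorials, written with binomial
    coefficients since differencing acts on them by a shift of the index. The
    bound N is arbitrary above m because the further terms vanish. *)
Lemma expn_sum_stirling2 (m N x : nat) : (m < N)%N ->
  (x ^ m)%N = (\sum_(k < N) stirling2 m k * k`! * 'C(x, k))%N.
Proof.
case: N => // N lt_mN; have := expn_sum_partition 'I_m 'I_x.
rewrite !card_ord => ->.
have lt_cardN (Q : {set {set 'I_m}}) :
    partition Q [set: 'I_m] -> (#|Q| < N.+1)%N.
  by move/leq_card_partition; rewrite cardsT card_ord => /leq_ltn_trans; apply.
(* A partition has at most m <= N blocks, so inord never truncates here. *)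
rewrite (partition_big (fun Q : {set {set 'I_m}} => inord #|Q| : 'I_N.+1)
           xpredT) //=.
apply: eq_bigr => k _.
rewrite -mulnA (mulnC k`!) bin_ffact /stirling2 -sum_nat_const.
apply: eq_big => [Q | Q /andP[partQ /eqP <-]]; last by rewrite inordK ?lt_cardN.
rewrite inE; case: (boolP (partition _ _)) => //= partQ.
by rewrite -val_eqE /= inordK ?lt_cardN.
Qed.

(** * Forward differences of polynomials *)

Definition fdiff (R : nzRingType) (p : {poly R}) : {poly R} :=
  p \Po ('X + 1) - p.

Section Diff.
Variable R : comNzRingType.
Implicit Types (p : {poly R}) (x : R) (n : nat).

Fact fdiff_is_linear : linear (@fdiff R).
Proof.
by move=> a p q; rewrite /fdiff linearP /= scalerBr opprD addrACA.
Qed.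
HB.instance Definition _ :=
  GRing.isLinear.Build R {poly R} {poly R} _ (@fdiff R) fdiff_is_linear.

Lemma iter_fdiff_sum n (I : Type) (r : seq I) (c : I -> R) (p : I -> {poly R}) :
  iter n (@fdiff R) (\sum_(i <- r) c i *: p i)
    = \sum_(i <- r) c i *: iter n (@fdiff R) (p i).
Proof.
elim: n => //= n ->; rewrite linear_sum /=; apply: eq_bigr => i _.
by rewrite linearZ.
Qed.

Lemma iter_fdiffZ n a p :
  iter n (@fdiff R) (a *: p) = a *: iter n (@fdiff R) p.
Proof. by elim: n => //= n ->; rewrite linearZ. Qed.

Lemma horner_fdiff p x : (fdiff p).[x] = p.[x + 1] - p.[x].
Proof. by rewrite /fdiff hornerD hornerN horner_comp !hornerE. Qed.

Lemma deriv_iter_fdiff n p :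
  (iter n (@fdiff R) p)^`() = iter n (@fdiff R) p^`().
Proof.
elim: n => //= n <-; rewrite /fdiff derivB deriv_comp derivD derivX.
by rewrite -polyC1 derivC addr0 mulr1.
Qed.

Lemma horner_iter_fdiff_shift n p y x :
  (iter n (@fdiff R) (p \Po ('X + y%:P))).[x] = (iter n (@fdiff R) p).[x + y].
Proof.
elim: n x => [|n IHn] x /=; first by rewrite horner_comp !hornerE.
by rewrite !horner_fdiff !IHn addrAC.
Qed.

(** Reflecting exchanges the two ends of a unit step, so each difference costs
    a sign and moves the base point back by one. *)
Lemma horner_iter_fdiff_reflect n p x :
  (iter n (@fdiff R) (p \Po (- 'X))).[x]
    = (-1) ^+ n * (iter n (@fdiff R) p).[- x - n%:R].
Proof.
elim: n x => [|n IHn] x /=; first by rewrite horner_comp !hornerE subr0.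
rewrite !horner_fdiff !IHn exprS -mulrBr mulN1r mulNr -mulrN opprB.
by congr (_ * (_.[_] - _.[_])); rewrite -natr1; ring.
Qed.

(** Newton's expansion can be differenced term by term by Pascal's rule. It is
    only assumed at the natural numbers, where binomial coefficients make
    sense without dividing in R. *)
Lemma iter_fdiff_newton n p (N : nat) (c : nat -> R) :
    (forall x : nat, p.[x%:R] = \sum_(k < N) c k * 'C(x, k)%:R) ->
  forall x : nat, (iter n (@fdiff R) p).[x%:R]
    = \sum_(k < N | (n <= k)%N) c k * 'C(x, k - n)%:R.
Proof.
move=> pE; elim: n => [|n IHn] x /=.
  by rewrite pE; apply: eq_bigr => k _; rewrite subn0.
rewrite horner_fdiff natr1 !IHn -sumrB.
rewrite big_mkcond [RHS]big_mkcond; apply: eq_bigr => k _.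
case: (ltngtP n k) => [ltnk | // | <-]; last by rewrite subnn !bin0 subrr.
by rewrite subnS -(prednK (_ : 0 < k - n)%N) ?subn_gt0 // binS natrD; ring.
Qed.

(** At x = 0 only the term k = n of the Newton expansion survives. *)
Lemma iter_fdiff_Xn0 n m :
  (iter n (@fdiff R) 'X^m).[0] = (n`! * stirling2 m n)%:R.
Proof.
(* The bound m + n makes room both for all terms of X^m and for k = n. *)
have XE (x : nat) : ('X^m : {poly R}).[x%:R]
    = \sum_(k < (m + n).+1) (stirling2 m k * k`!)%:R * 'C(x, k)%:R.
  rewrite hornerXn -natrX (@expn_sum_stirling2 m (m + n).+1) ?ltnS ?leq_addr //.
  by rewrite natr_sum; apply: eq_bigr => k _; rewrite natrM.
have ltn_mn : (n < (m + n).+1)%N by rewrite ltnS leq_addl.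
rewrite -[0]/(0%:R).
rewrite (iter_fdiff_newton (c := fun k => (stirling2 m k * k`!)%:R) n XE).
rewrite (bigD1 (Ordinal ltn_mn)) //=.
rewrite subnn bin0 mulr1 mulnC big1 ?addr0 // => k /andP[le_nk].
rewrite -val_eqE /= => ne_kn.
by rewrite bin0n subn_eq0 leqNgt ltn_neqAle eq_sym ne_kn le_nk mulr0.
Qed.

(** Translation by y turns X^m into (X + y)^m without affecting differences;
    the binomial theorem reduces the value at y to values at 0. *)
Lemma horner_iter_fdiff_Xn n m y :
  (iter n (@fdiff R) 'X^m).[y]
    = \sum_(j < m.+1) (n`! * ('C(m, j) * stirling2 (m - j) n))%:R * y ^+ j.
Proof.
rewrite -[y in LHS]add0r -horner_iter_fdiff_shift comp_Xn_poly exprDn.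
rewrite (eq_bigr (fun j : 'I_m.+1 => ('C(m, j)%:R * y ^+ j) *: 'X^(m - j))).
  rewrite iter_fdiff_sum horner_sum; apply: eq_bigr => j _.
  by rewrite hornerZ iter_fdiff_Xn0 !natrM; ring.
move=> j _; rewrite -mul_polyC polyCM polyCMn polyC_exp -mulr_natl; ring.
Qed.

(** The term j = 0 of the expansion at -z is the value at 0, and the terms with
    j > m - n vanish, as S(m-j,n) = 0. *)
Lemma horner_stirling_poly n m z :
  n`!%:R * (stirling_poly R m n).[z]
    = (iter n (@fdiff R) 'X^m).[- z] - (iter n (@fdiff R) 'X^m).[0].
Proof.
rewrite iter_fdiff_Xn0 horner_iter_fdiff_Xn big_ord_recl /= bin0 mul1n subn0.
rewrite expr0 mulr1 addrAC subrr add0r.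
rewrite /stirling_poly horner_sum mulr_sumr big_add1 /= [LHS]big_mkord.
rewrite (big_ord_widen m (fun j => n`!%:R *
  ((('C(m, j.+1) * stirling2 (m - j.+1) n)%:R : {poly R})
     * (- 'X) ^+ j.+1).[z])) ?leq_subr // big_mkcond.
apply: eq_bigr => j _; rewrite /bump leq0n add1n.
case: ifPn => [_ | ].
  rewrite hornerM -polyC1 -polyCMn hornerC horner_exp hornerN hornerX.
  by rewrite natrM mulrA.
rewrite -leqNgt => le_dj; rewrite stirling2_small ?muln0 ?mul0r //.
by rewrite ltn_subLR ?ltn_ord // addSn ltnS addnC -leq_subLR.
Qed.
End Diff.

(** * Monotonicity, symmetry and level sets *)

Section Real.
Variable R : rcfType.
Implicit Types x y : R.

Lemma horner_deriv_fdiff_Xn n m x :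
  (iter n (@fdiff R) 'X^m)^`().[x] = m%:R * (iter n (@fdiff R) 'X^(m.-1)).[x].
Proof.
rewrite deriv_iter_fdiff derivXn -scaler_nat.
by rewrite iter_fdiffZ hornerZ.
Qed.

Lemma deriv_gt0_ltr_horner (p : {poly R}) :
  (forall x, 0 < p^`().[x]) -> {homo horner p : x y / x < y}.
Proof.
move=> dp x y ltxy; apply: (@ltr_hornerW _ _ x y) => //;
  by rewrite in_itv /= lexx ltW.
Qed.

Lemma ltr_exprn_odd d : odd d -> {homo (fun x : R => x ^+ d) : x y / x < y}.
Proof.
move=> odd_d x y ltxy; have d_gt0 : (0 < d)%N by case: d odd_d.
have [x_ge0|x_lt0] := leP 0 x; first by rewrite ltrXn2r -?lt0n.
have [y_ge0|y_lt0] := leP 0 y.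
  by rewrite (@lt_le_trans _ _ 0) ?exprn_odd_lt0 ?exprn_odd_ge0.
rewrite -ltrN2; have flip u : - u ^+ d = (- u) ^+ d.
  by rewrite [RHS]exprNn -signr_odd odd_d expr1 mulN1r.
by rewrite !flip ltrXn2r -?lt0n ?oppr_ge0 ?ltrN2 // ltW.
Qed.

(** Differentiating trades one power for the hypothesis at n: the derivative
    at n + 1 is a positive multiple of an increment of the polynomial at n,
    over a step of length 1. *)
Lemma fdiff_Xn_increasing n d : odd d ->
  {homo horner (iter n (@fdiff R) 'X^(n + d)) : x y / x < y}.
Proof.
move=> odd_d; elim: n => [|n IHn].
  by move=> x y ltxy; rewrite !hornerXn ltr_exprn_odd.
apply: deriv_gt0_ltr_horner => x.
rewrite horner_deriv_fdiff_Xn /= mulr_gt0 ?ltr0n //.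
by rewrite horner_fdiff subr_gt0; apply: IHn; rewrite ltrDl ltr01.
Qed.

(** Since X^(n+d) has the parity of n, its sign under x -> -x cancels the sign
    (-1)^n produced by reflecting n differences. *)
Lemma fdiff_Xn_reflect n d : ~~ odd d ->
  (iter n (@fdiff R) 'X^(n + d)).[- n%:R] = (iter n (@fdiff R) 'X^(n + d)).[0].
Proof.
move=> even_d; have := horner_iter_fdiff_reflect n ('X^(n + d) : {poly R}) 0.
have -> : 'X^(n + d) \Po (- 'X) = (-1) ^+ n *: ('X^(n + d) : {poly R}).
  rewrite comp_Xn_poly [LHS]exprNn -[in LHS]signr_odd oddD (negPf even_d) addbF.
  by rewrite mulr_sign -[in RHS]signr_odd scaler_sign.
rewrite iter_fdiffZ hornerZ oppr0 sub0r => /(can_inj (signrMK _)) ->.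
by [].
Qed.

Lemma rolle_lt (p : {poly R}) x y : x < y -> p.[x] = p.[y] ->
  exists2 c, x < c < y & p^`().[c] = 0.
Proof.
by move=> ltxy /(poly_rolle ltxy)[c]; rewrite in_itv /=; exists c.
Qed.

(** Three points on one level give two distinct zeros of the derivative. *)
Lemma no_three_on_level (p : {poly R}) x y z :
    {homo horner p^`() : u v / u < v} ->
    x < y -> y < z -> p.[x] = p.[y] -> p.[y] = p.[z] -> False.
Proof.
move=> dp ltxy ltyz /(rolle_lt ltxy)[c /andP[_ ltcy] dc].
move=> /(rolle_lt ltyz)[e /andP[ltye _] de].
by have := dp c e (lt_trans ltcy ltye); rewrite dc de ltxx.
Qed.
End Real.

Theorem proposition6 (R : realType) (m n : nat) (hm : (0 < m)%N)
    (hn : (0 < n)%N) (hd : (0 < m - n)%N) :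
  forall z : R, root (stirling_poly R m n) z -> z = 0 \/ z = n%:R.
Proof.
move=> z /rootP Pz0.
have [d d_gt0 mE] : exists2 d, (0 < d)%N & m = (n + d)%N.
  by exists (m - n)%N; rewrite ?subnKC // ltnW // -subn_gt0.
have := horner_stirling_poly n m z; rewrite Pz0 mulr0 => /esym/eqP.
rewrite subr_eq0 {}mE => /eqP FzE.
have [odd_d | even_d] := boolP (odd d).
  left; apply: contra_eq (FzE) => nz_z.
  have := nz_z; rewrite -oppr_eq0.
  case/lt_total/orP => /(fdiff_Xn_increasing n odd_d) lt_F.
    by rewrite lt_eqF.
  by rewrite gt_eqF.
have dF : {homo horner (iter n (@fdiff R) 'X^(n + d))^`() : x y / x < y}.
  move=> x y ltxy; rewrite !horner_deriv_fdiff_Xn -subn1 -addnBA //.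
  rewrite ltr_pM2l ?ltr0n ?addn_gt0 ?d_gt0 ?orbT //.
  by apply: fdiff_Xn_increasing => //; rewrite oddB // (negPf even_d).
have FnE := fdiff_Xn_reflect R n even_d.
have n_lt0 : - n%:R < 0 :> R by rewrite oppr_lt0 ltr0n.
case: (ltgtP (- z) 0) => [z_lt0 | z_gt0 | /eqP]; last first.
- by rewrite oppr_eq0 => /eqP; left.
- by case: (no_three_on_level dF n_lt0 z_gt0).
case: (ltgtP (- z) (- n%:R)) => [lt_zn | gt_zn | /oppr_inj]; last by right.
- by case: (no_three_on_level dF lt_zn n_lt0); rewrite ?FzE ?FnE.
by case: (no_three_on_level dF gt_zn z_lt0); rewrite ?FzE ?FnE.
Qed.
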